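(* Let $(X,\mathcal{A})$ be a measurable space and let $\mu\colon\mathcal{A}\to[0,\infty]$ be a nonadditive measure. Assume that $\mu$ has property (C) and the pseudometric generating property (p.g.p.). (1) A sequence $\{f_n\}_{n\in\mathbb{N}}\subset\mathcal{L}^0(\mu)$ is Cauchy (with respect to $\|\cdot\|_0$) if and only if it converges (with respect to $\|\cdot\|_0$) to an element of $\mathcal{L}^0(\mu)$. (2) Additionally, assume that $\mu$ is null-additive. A sequence $\{[f_n]\}_{n\in\mathbb{N}}\subset L^0(\mu)$ is Cauchy if and only if it converges to an element of $L^0(\mu)$.
   Context: $X$ is a nonempty set and $\mathcal{A}$ is a $\sigma$-field of subsets of $X$. A nonadditive measure is a set function $\mu\colon\mathcal{A}\to[0,\infty]$ with $\mu(\emptyset)=0$ and $\mu(A)\le\mu(B)$ whenever $A,B\in\mathcal{A}$, $A\subset B$. $\mathcal{F}_0(X)$ is the real linear space of all $\mathcal{A}$-measurable functions $X\to\mathbb{R}$. Property (C): for any sequence $\{E_n\}_{n\in\mathbb{N}}\subset\mathcal{A}$, if $\sup_{l\in\mathbb{N}}\mu\left(\bigcup_{n=k}^{k+l}E_n\right)\to 0$ as $k\to\infty$, then $\mu\left(\bigcup_{n=k}^\infty E_n\right)\to 0$ as $k\to\infty$. (p.g.p.): $\mu(A_n\cup B_n)\to 0$ whenever $A_n,B_n\in\mathcal{A}$ and $\max\{\mu(A_n),\mu(B_n)\}\to 0$. Null-additive: $\mu(A\cup B)=\mu(A)$ whenever $A,B\in\mathcal{A}$ and $\mu(B)=0$.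 Let $\varphi\colon[0,\infty]\to[0,\pi/2]$, $\varphi(t)=\arctan t$ for $t\neq\infty$ and $\varphi(\infty)=\pi/2$. For $f\in\mathcal{F}_0(X)$ let $\|f\|_0:=\inf_{c>0}\varphi\bigl(c+\mu(\{|f|>c\})\bigr)$. The space $\mathcal{F}_0(X)$ equipped with $\|\cdot\|_0$ is denoted $\mathcal{L}^0(\mu)$. For $\mu$ null-additive, $f\sim g$ iff $\mu(\{|f-g|>c\})=0$ for every $c>0$ defines an equivalence relation on $\mathcal{F}_0(X)$; $[f]$ is the class of $f$, $L^0(\mu):=\{[f]: f\in\mathcal{L}^0(\mu)\}$ with $[f]+[g]:=[f+g]$, $c[f]:=[cf]$, and $\|[f]\|_0:=\|f\|_0$ (well-defined when $\mu$ is null-additive). A sequence $\{x_n\}$ converges to $x$ if $\|x_n-x\|_0\to 0$; it is Cauchy if for any $\varepsilon>0$ there is $n_0$ with $\|x_m-x_n\|_0<\varepsilon$ for all $m,n\ge n_0$. (No triangle inequality is assumed.) *)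

(* Defs.v *)
From HB Require Import structures.
From mathcomp Require Import all_boot all_order all_algebra generic_quotient.
From mathcomp Require Import all_classical all_reals all_analysis measurable_realfun.
Import Order.TTheory GRing.Theory Num.Theory.
Import numFieldNormedType.Exports.

Set Implicit Arguments.
Unset Strict Implicit.
Unset Printing Implicit Defensive.

Local Open Scope classical_set_scope.
Local Open Scope ring_scope.
Local Open Scope quotient_scope.

(* The values of a nonadditive measure outside the sigma-field are irrelevant:
   they are never used below. *)
Record nonadditive_measure d (X : measurableType d) (R : realType) := {
  nonadd_fun :> set X -> \bar R ;
  nonadd_ge0 : forall A, measurable A -> (0 <= nonadd_fun A)%E ;
  nonadd0 : nonadd_fun set0 = 0%E ;
  nonadd_le : forall A B, measurable A -> measurable B -> A `<=` B ->
    (nonadd_fun A <= nonadd_fun B)%E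
}.

Section nonadditive_measure_properties.
Context d (X : measurableType d) (R : realType).
Variable mu : nonadditive_measure X R.

Definition property_C : Prop :=
  forall E : nat -> set X, (forall n, measurable (E n)) ->
    (fun k => ereal_sup
       [set mu (\bigcup_(n in [set n | (k <= n <= k + l)%N]) E n)
         | l in [set: nat]]) @ \oo --> 0%E ->
    (fun k => mu (\bigcup_(n in [set n | (k <= n)%N]) E n)) @ \oo --> 0%E.

Definition pseudometric_generating : Prop :=
  forall A B : nat -> set X,
    (forall n, measurable (A n)) -> (forall n, measurable (B n)) ->
    (fun n => Order.max (mu (A n)) (mu (B n))) @ \oo --> 0%E ->
    (fun n => mu (A n `|` B n)) @ \oo --> 0%E.

Definition null_additive : Prop :=
  forall A B, measurable A -> measurable B -> mu B = 0%E ->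
    mu (A `|` B) = mu A.

End nonadditive_measure_properties.

(* Only used on nonnegative arguments; the value at -oo is arbitrary. *)
Definition arctan_ext (R : realType) (t : \bar R) : R :=
  match t with
  | r%:E => atan r
  | +oo%E => pi / 2
  | -oo%E => - (pi / 2)
  end.

Section cauchy_and_convergent.
Context (R : realType) (V : zmodType).
Variable N : V -> R.

Definition cauchy_for (x : nat -> V) : Prop :=
  forall e : R, 0 < e -> exists n0 : nat, forall m n : nat,
    (n0 <= m)%N -> (n0 <= n)%N -> N (x m - x n) < e.

Definition converges_for (x : nat -> V) (a : V) : Prop :=
  (fun n => N (x n - a)) @ \oo --> (0 : R).

End cauchy_and_convergent.

Section space_of_measurable_functions.
Context d (X : measurableType d) (R : realType).
Variable mu : nonadditive_measure X R.

Implicit Types f g h : {mfun X >-> R}.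

Definition norm0 f : R :=
  inf [set arctan_ext (c%:E + mu [set x | (c < `|f x|)%R])%E
    | c in [set c : R | 0 < c]].

Definition null_eq f g : bool :=
  `[< forall c : R, 0 < c -> mu [set x | c < `|f x - g x|] = 0%E >].

Lemma measurable_gt_norm f (c : R) : measurable [set x | c < `|f x|].
Proof.
have mnf : measurable_fun setT (fun x => `|f x|).
  by apply: measurableT_comp; first exact: normr_measurable.
rewrite [X in measurable X](_ : _ = [set: X] `&` (fun x => `|f x|) @^-1` `]c, +oo[).
  by apply: mnf => //; exact: measurable_itv.
by rewrite setTI; apply/seteqP; split => x; rewrite /= in_itv/= andbT.
Qed.

Lemma measurable_gt_normB f g (c : R) : measurable [set x | c < `|f x - g x|].
Proof. exact: (measurable_gt_norm (f - g)). Qed.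

Lemma null_eq_refl : reflexive null_eq.
Proof.
move=> f; apply/asboolP => c c0.
rewrite [X in mu X](_ : _ = set0) ?nonadd0//.
by apply/seteqP; split => // x /=; rewrite subrr normr0 ltNge ltW.
Qed.

Lemma null_eq_sym : symmetric null_eq.
Proof.
move=> f g; apply/asboolP/asboolP => H c c0; rewrite -(H c c0);
  by congr (mu _); apply/seteqP; split => x /=; rewrite distrC.
Qed.

Hypothesis mu_null : null_additive mu.

Lemma null_sub2 (A B C : set X) :
  measurable A -> measurable B -> measurable C ->
  C `<=` A `|` B -> mu A = 0%E -> mu B = 0%E -> mu C = 0%E.
Proof.
move=> mA mB mC CAB A0 B0; apply/eqP; rewrite eq_le nonadd_ge0// andbT.
rewrite -A0 -(mu_null mA mB B0); apply: nonadd_le => //.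
exact: measurableU.
Qed.

Lemma null_eq_trans : transitive null_eq.
Proof.
move=> g f h /asboolP fg /asboolP gh; apply/asboolP => c c0.
have c20 : 0 < c / 2 by rewrite divr_gt0.
apply: (null_sub2 _ _ _ _ (fg _ c20) (gh _ c20));
  [exact: measurable_gt_normB..|].
move=> x /= cfh.
have [fgx|] := ltP (c / 2) `|f x - g x|; first by left.
move=> fgx; right; rewrite ltNge; apply/negP => ghx.
move: cfh; rewrite ltNge => /negP; apply.
by rewrite (le_trans (ler_distD (g x) _ _))// (splitr c) lerD.
Qed.

Definition null_eq_equiv : equiv_rel {mfun X >-> R} :=
  EquivRel null_eq null_eq_refl null_eq_sym null_eq_trans.

Definition L0 : Type := {eq_quot null_eq_equiv}.
HB.instance Definition _ := Choice.on L0.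
HB.instance Definition _ := EqQuotient.on L0.

Lemma L0P f g : reflect (\pi_L0 f = \pi_L0 g) (null_eq f g).
Proof. by apply: (iffP idP) => [fg|/eqmodP//]; apply/eqmodP. Qed.

Lemma null_eq_repr f : null_eq (repr (\pi_L0 f)) f.
Proof. by apply/L0P; rewrite reprK. Qed.

Lemma null_eqD f f' g g' : null_eq f f' -> null_eq g g' -> null_eq (f + g) (f' + g').
Proof.
move=> ff gg; apply: (@null_eq_trans (f' + g)).
- move: ff => /asboolP ff; apply/asboolP => c c0; rewrite -(ff c c0).
  congr (mu _); apply/seteqP; split => x /=;
  by rewrite opprD addrACA subrr addr0.
- move: gg => /asboolP gg; apply/asboolP => c c0; rewrite -(gg c c0).
  congr (mu _); apply/seteqP; split => x /=;
  by rewrite opprD addrACA subrr add0r.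
Qed.

Lemma null_eqZ (a : R) f f' : null_eq f f' -> null_eq (a *: f) (a *: f').
Proof.
move=> /asboolP ff; have [->|a0] := eqVneq a 0.
  by rewrite !scale0r null_eq_refl.
have na : 0 < `|a| by rewrite normr_gt0.
apply/asboolP => c c0; rewrite -(ff (c / `|a|)) ?divr_gt0//.
congr (mu _); apply/seteqP; split => x /=;
by rewrite -mulrBr normrM ltr_pdivrMr// mulrC.
Qed.

Lemma null_eqN f f' : null_eq f f' -> null_eq (- f) (- f').
Proof. by rewrite -(scaleN1r f) -(scaleN1r f'); exact: null_eqZ. Qed.

Definition L0_zero : L0 := \pi_L0 0.
Definition L0_opp := lift_op1 L0 (fun f => - f).
Definition L0_add := lift_op2 L0 (fun f g => f + g).
Definition L0_scale (a : R) := lift_op1 L0 (fun f => a *: f).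

Lemma L0_oppE f : L0_opp (\pi_L0 f) = \pi_L0 (- f).
Proof. by unlock L0_opp; apply/L0P; apply: null_eqN; exact: null_eq_repr. Qed.

Lemma L0_addE f g : L0_add (\pi_L0 f) (\pi_L0 g) = \pi_L0 (f + g).
Proof. by unlock L0_add; apply/L0P; apply: null_eqD; exact: null_eq_repr. Qed.

Lemma L0_scaleE a f : L0_scale a (\pi_L0 f) = \pi_L0 (a *: f).
Proof. by rewrite /L0_scale; unlock; apply/L0P; apply: null_eqZ; exact: null_eq_repr. Qed.

Lemma L0_addA : associative L0_add.
Proof.
by move=> u v w; rewrite -[u]reprK -[v]reprK -[w]reprK !L0_addE addrA.
Qed.

Lemma L0_addC : commutative L0_add.
Proof. by move=> u v; rewrite -[u]reprK -[v]reprK !L0_addE addrC. Qed.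

Lemma L0_add0 : left_id L0_zero L0_add.
Proof. by move=> u; rewrite -[u]reprK L0_addE add0r. Qed.

Lemma L0_addN : left_inverse L0_zero L0_opp L0_add.
Proof. by move=> u; rewrite -[u]reprK L0_oppE L0_addE addNr. Qed.

HB.instance Definition _ := GRing.isZmodule.Build L0
  L0_addA L0_addC L0_add0 L0_addN.

Lemma L0_scaleA a b u :
  L0_scale a (L0_scale b u) = L0_scale (a * b) u.
Proof. by rewrite -[u]reprK !L0_scaleE scalerA. Qed.

Lemma L0_scale1 : left_id 1 L0_scale.
Proof. by move=> u; rewrite -[u]reprK L0_scaleE scale1r. Qed.

Lemma L0_scaleDr : right_distributive L0_scale +%R.
Proof.
move=> a u v; rewrite -[u]reprK -[v]reprK /GRing.add/=.
by rewrite !(L0_addE, L0_scaleE) scalerDr.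
Qed.

Lemma L0_scaleDl u : {morph L0_scale^~ u : a b / a + b}.
Proof.
move=> a b; rewrite -[u]reprK !L0_scaleE {2}/GRing.add/=.
by rewrite L0_addE scalerDl.
Qed.

HB.instance Definition _ := GRing.Zmodule_isLmodule.Build R L0
  L0_scaleA L0_scale1 L0_scaleDr L0_scaleDl.

Lemma L0_piD f g : \pi_L0 f + \pi_L0 g = \pi_L0 (f + g).
Proof. exact: L0_addE. Qed.

Lemma L0_piN f : - \pi_L0 f = \pi_L0 (- f).
Proof. exact: L0_oppE. Qed.

Lemma L0_piZ a f : a *: \pi_L0 f = \pi_L0 (a *: f).
Proof. exact: L0_scaleE. Qed.

Definition L0_norm (u : L0) : R := norm0 (repr u).

Lemma arctan_ext_ge0 (t : \bar R) : (0 <= t)%E -> 0 <= arctan_ext t.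
Proof.
case: t => //= [r|_]; last by rewrite divr_ge0// pi_ge0.
rewrite lee_fin le_eqVlt => /predU1P[<-|r0]; first by rewrite atan0.
by rewrite -atan0 ltW// lt_atan.
Qed.

Lemma arctan_ext_le (s t : \bar R) : (s <= t)%E -> arctan_ext s <= arctan_ext t.
Proof.
case: s t => [r| |] [s| |] //=; rewrite ?lee_fin.
- by rewrite le_eqVlt => /predU1P[->//|rs]; rewrite ltW// lt_atan.
- by move=> _; rewrite ltW// atan_ltpi2.
- by move=> _; rewrite ltW// atan_gtNpi2.
- by move=> _; rewrite ge0_cp ?divr_ge0 ?pi_ge0.
Qed.

Lemma arctan_ext_shift (t : \bar R) (e : R) : (0 <= t)%E -> 0 < e ->
  exists2 h : R, 0 < h & arctan_ext (t + h%:E) <= arctan_ext t + e.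
Proof.
case: t => //= [r _ e0|_ e0]; last by exists 1; rewrite // lerDl ltW.
have /cvgrPdist_le/(_ e e0)/nbhs_ballP[h /= h0 hr] := @continuous_atan _ r.
exists (h / 2); first by rewrite divr_gt0.
have /hr : ball r h (r + h / 2).
  rewrite /ball/= opprD addrA subrr add0r normrN gtr0_norm ?divr_gt0//.
  by rewrite ltr_pdivrMr// ltr_pMr// ltr1n.
by rewrite distrC => /(le_trans (ler_norm _)); rewrite lerBlDl.
Qed.

Lemma norm0_le_null_eq f g : null_eq f g -> norm0 f <= norm0 g.
Proof.
move=> /asboolP fg; rewrite /norm0; apply: lb_le_inf.
  by exists (arctan_ext (1%:E + mu [set x | (1 < `|g x|)%R])%E), 1 => /=.
move=> _ [c /= c0 <-]; apply/ler_addgt0Pr => e e0.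
have t0 : (0 <= c%:E + mu [set x | (c < `|g x|)%R])%E.
  rewrite adde_ge0 ?lee_fin ?(ltW c0)//.
  by apply: nonadd_ge0; exact: measurable_gt_norm.
have [h h0 /(le_trans _)] := arctan_ext_shift t0 e0; apply.
have ch0 : 0 < c + h by rewrite addr_gt0.
apply: (@le_trans _ _
    (arctan_ext ((c + h)%:E + mu [set x | (c + h < `|f x|)%R])%E)).
  apply: ge_inf; last by exists (c + h).
  exists 0 => _ [k /= k0 <-]; apply: arctan_ext_ge0.
  rewrite adde_ge0 ?lee_fin ?(ltW k0)//.
  by apply: nonadd_ge0; exact: measurable_gt_norm.
apply: arctan_ext_le; rewrite EFinD addeAC leeD2r// leeD2l//.
have mg := measurable_gt_norm g c.
have mfg := measurable_gt_normB f g h.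
rewrite -(mu_null mg mfg (fg h h0)); apply: nonadd_le.
- exact: measurable_gt_norm.
- exact: measurableU.
move=> x /= chf; have [|gx] := ltP c `|g x|; first by left.
right; rewrite ltNge; apply/negP => fgx.
move: chf; rewrite ltNge => /negP; apply.
by rewrite -(subrK (g x) (f x)) addrC (le_trans (ler_normD _ _))// lerD.
Qed.

Lemma L0_normE f : L0_norm (\pi_L0 f) = norm0 f.
Proof.
apply/eqP; rewrite eq_le; apply/andP; split; apply: norm0_le_null_eq.
  exact: null_eq_repr.
by rewrite null_eq_sym; exact: null_eq_repr.
Qed.

End space_of_measurable_functions.

(* Main.v *)
Require Import Defs.
From mathcomp Require Import all_boot all_order all_algebra.
From mathcomp Require Import all_classical all_reals all_analysis measurable_realfun.
From mathcomp Require Import lra.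
Import Order.TTheory GRing.Theory Num.Theory.
Import numFieldNormedType.Exports.

Set Implicit Arguments.
Unset Strict Implicit.
Unset Printing Implicit Defensive.

Local Open Scope classical_set_scope.
Local Open Scope ring_scope.
Local Open Scope quotient_scope.

(** Smallness of [norm0 mu f] amounts to [mu {|f| > e} < e] for a small [e], so
    everything reduces to Cauchyness and convergence in [mu]-measure.  (p.g.p.)
    has an epsilon-delta form, which replaces the triangle inequality and shows
    that convergent sequences are Cauchy.  Conversely, choose scales
    [r k <= 2^-k] such that two sets of measure less than [r k.+1] have a union
    of measure less than [r k], and [p k] such that
    [E k = {|f (p k.+1) - f (p k)| > r k.+1}] has measure less than [r k.+1].
    All finite unions of the [E n] with [n >= k] then have measure less than
    [r k], so (C) makes the measure of the tails [F k] of [E] tend to 0.  Off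
    [F k] the [f (p i)], [i >= k], form a geometrically Cauchy sequence; its
    limit, set to 0 on the intersection of the [F k], is the limit of [f]. *)

(** * Null sequences in the extended reals and geometrically Cauchy real sequences *)

Lemma ereal_cvg0P (R : realType) (u : nat -> \bar R) :
  (forall n, 0 <= u n)%E ->
  (u @ \oo --> 0%E) <-> (forall e : R, 0 < e -> \forall n \near \oo, (u n < e%:E)%E).
Proof.
move=> u0; split => [uc e e0|H].
- by apply: (uc [set y | (y < e%:E)%E]); exists e => //= r /=;
    rewrite sub0r normrN lte_fin => /(le_lt_trans (ler_norm _)).
- move=> A [e /= e0 eA]; have := H e e0; apply: filterS => n /= une.
  have := u0 n; case: (u n) une => //= r; rewrite lte_fin lee_fin => re r0.
  by apply: eA; rewrite /= sub0r normrN ger0_norm.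
Qed.

Lemma steps_le_expr_dist (R : realType) (s : nat -> R) (k : nat) :
  (forall n, (k <= n)%N -> `|s n.+1 - s n| <= 2^-1 ^+ n.+1) ->
  forall i j, (k <= i)%N -> (i <= j)%N -> `|s j - s i| <= 2^-1 ^+ i.
Proof.
move=> sk i j ki /subnKC <-; set l := (j - i)%N.
(* The exact geometric sum, unlike the bare bound [2^-1 ^+ i], is preserved by induction on [l]. *)
suff : `|s (i + l)%N - s i| <= 2^-1 ^+ i - 2^-1 ^+ (i + l).
  by move/le_trans; apply; rewrite gerBl exprn_ge0.
elim: l => [|l IH]; first by rewrite addn0 !subrr normr0.
rewrite addnS; have := sk (i + l)%N (leq_trans ki (leq_addr _ _)).
have := ler_distD (s (i + l)%N) (s (i + l).+1) (s i).
rewrite exprS; move: IH; lra.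
Qed.

Lemma expr_half_lt (R : realType) (e : R) : 0 < e ->
  \forall n \near \oo, (2^-1 : R) ^+ n < e.
Proof.
move=> e0; have := near_infty_natSinv_expn_lt (PosNum e0).
by apply: filterS => n /=; rewrite div1r exprVn.
Qed.

Lemma expr_dist_cvg (R : realType) (s : nat -> R) (k : nat) :
  (forall i j, (k <= i)%N -> (i <= j)%N -> `|s j - s i| <= 2^-1 ^+ i) ->
  cvgn s /\ (forall i, (k <= i)%N -> `|limn s - s i| <= 2^-1 ^+ i).
Proof.
move=> sk.
have sc : cvgn s.
  apply/cauchy_cvgP; apply: cauchy_exP => e e0.
  have [N _ Ne] := expr_half_lt e0.
  exists (s (maxn k N)); exists (maxn k N) => // j /= Nj.
  rewrite /ball/= distrC.
  by apply: le_lt_trans (sk _ _ (leq_maxl _ _) Nj) (Ne _ _); rewrite /= leq_maxr.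
split=> // i ki.
have : (fun j => `|s j - s i|) @ \oo --> `|limn s - s i|.
  by apply: cvg_norm; apply: cvgB => //; exact: cvg_cst.
move=> cc; rewrite -(cvg_lim _ cc)//; apply: limr_le; first by apply: cvgP cc.
by exists i => // j /=; exact: sk.
Qed.

Section nonadditive.
Context (R : realType) d (X : measurableType d).
Variable mu : nonadditive_measure X R.
Implicit Types f g : {mfun X >-> R}.

(** * Smallness of [norm0] against smallness in [mu]-measure *)

Lemma norm0_ge0 f : 0 <= norm0 mu f.
Proof.
apply: lb_le_inf.
  by exists (arctan_ext (1%:E + mu [set x | (1 < `|f x|)%R])%E), 1 => /=.
move=> _ [c /= c0 <-]; apply: arctan_ext_ge0.
by rewrite adde_ge0 ?lee_fin ?(ltW c0)// nonadd_ge0//; exact: measurable_gt_norm.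
Qed.

(** With [r = atan e], monotonicity of the arctangent yields some [c] such that
    [c + mu {|f| > c} < e]. Then [c < e], so [{|f| > e}] lies in [{|f| > c}]. *)
Lemma norm0_lt_measure (e : R) : 0 < e ->
  exists2 r : R, 0 < r &
    forall f, norm0 mu f < r -> (mu [set x | (e < `|f x|)%R] < e%:E)%E.
Proof.
move=> e0; exists (atan e); first by rewrite -atan0 lt_atan.
move=> f /inf_lt[|_ [c /= c0 <-]].
  by exists (arctan_ext (1%:E + mu [set x | (1 < `|f x|)%R])%E), 1 => /=.
rewrite ltNge => ae.
have m0 : (0 <= mu [set x | (c < `|f x|)%R])%E.
  by apply: nonadd_ge0; exact: measurable_gt_norm.
have ce : (c%:E + mu [set x | (c < `|f x|)%R] < e%:E)%E.
  rewrite ltNge; apply: contra ae => ec.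
  exact: (@arctan_ext_le _ e%:E).
have /ltW cle : c < e.
  by rewrite -lte_fin; apply: le_lt_trans ce; rewrite leeDl.
apply: (@le_lt_trans _ _ (mu [set x | (c < `|f x|)%R])).
  apply: nonadd_le; try exact: measurable_gt_norm.
  by move=> x /=; exact: le_lt_trans.
by apply: le_lt_trans ce; rewrite leeDr// lee_fin ltW.
Qed.

(** The choice [c = r] in the infimum bounds [norm0] by [atan (r + r)], which is small by continuity
    at 0. With [r = h / 3], the sum [r + r] stays inside the ball of radius [h]. *)
Lemma measure_lt_norm0 (e : R) : 0 < e ->
  exists2 r : R, 0 < r &
    forall f, (mu [set x | (r < `|f x|)%R] < r%:E)%E -> norm0 mu f < e.
Proof.
move=> e0.
have /cvgrPdist_lt/(_ e e0)/nbhs_ballP[h /= h0 hr] := @continuous_atan R 0.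
exists (h / 3); first by rewrite divr_gt0.
move=> f fr; have h30 : 0 < h / 3 by rewrite divr_gt0.
apply: (@le_lt_trans _ _ (atan (h / 3 + h / 3))).
  apply: (@le_trans _ _ (arctan_ext
      ((h / 3)%:E + mu [set x | (h / 3 < `|f x|)%R])%E)).
    apply: ge_inf; last by exists (h / 3).
    exists 0 => _ [k /= k0 <-]; apply: arctan_ext_ge0.
    rewrite adde_ge0 ?lee_fin ?(ltW k0)//.
    by apply: nonadd_ge0; exact: measurable_gt_norm.
  apply: (@arctan_ext_le _ _ (h / 3 + h / 3)%:E).
  by rewrite EFinD leeD2l// ltW.
have /hr : ball (0 : R) h (h / 3 + h / 3).
  by rewrite /ball/= sub0r normrN gtr0_norm; lra.
by rewrite atan0 sub0r normrN => /(le_lt_trans (ler_norm _)).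
Qed.

Lemma cauchy_norm0P (f : nat -> {mfun X >-> R}) :
  cauchy_for (norm0 mu) f <->
  forall e : R, 0 < e -> exists n0 : nat, forall m n : nat,
    (n0 <= m)%N -> (n0 <= n)%N ->
    (mu [set x | (e < `|f m x - f n x|)%R] < e%:E)%E.
Proof.
split=> cf e e0.
- have [r r0 rP] := norm0_lt_measure e0; have [n0 n0P] := cf r r0.
  by exists n0 => m n mn nn; exact: rP (n0P _ _ mn nn).
- have [r r0 rP] := measure_lt_norm0 e0; have [n0 n0P] := cf r r0.
  by exists n0 => m n mn nn; apply: rP; exact: n0P.
Qed.

Lemma converges_norm0P (f : nat -> {mfun X >-> R}) g :
  converges_for (norm0 mu) f g <->
  forall e : R, 0 < e -> \forall n \near \oo,
    (mu [set x | (e < `|f n x - g x|)%R] < e%:E)%E.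
Proof.
split=> [cf e e0|cf].
- have [r r0 rP] := norm0_lt_measure e0.
  move/cvgrPdist_lt : cf => /(_ r r0); apply: filterS => n.
  by rewrite sub0r normrN => /(le_lt_trans (ler_norm _)); exact: rP.
- apply/cvgrPdist_lt => e e0; have [r r0 rP] := measure_lt_norm0 e0.
  apply: filterS (cf r r0) => n /= nr.
  by rewrite sub0r normrN ger0_norm ?norm0_ge0//; exact: rP.
Qed.

Lemma nonadd_lt (A B : set X) (t : \bar R) : measurable A -> measurable B ->
  A `<=` B -> (mu B < t)%E -> (mu A < t)%E.
Proof. by move=> mA mB AB; apply: le_lt_trans; exact: nonadd_le. Qed.

(** * Uniform consequences of (p.g.p.) *)

Hypothesis mu_pgp : pseudometric_generating mu.

(** Otherwise counterexamples for the thresholds [1 / (n + 1)] form two sequences that violate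
    (p.g.p.). *)
Lemma pgp_lt (e : R) : 0 < e ->
  exists2 r : R, 0 < r & forall A B, measurable A -> measurable B ->
    (mu A < r%:E)%E -> (mu B < r%:E)%E -> (mu (A `|` B) < e%:E)%E.
Proof.
move=> e0; apply: contrapT => H.
have {}H (n : nat) : exists AB : set X * set X,
    [/\ measurable AB.1, measurable AB.2, (mu AB.1 < (n.+1%:R^-1)%:E)%E,
      (mu AB.2 < (n.+1%:R^-1)%:E)%E & (e%:E <= mu (AB.1 `|` AB.2))%E].
  apply: contrapT => nH; apply: H; exists n.+1%:R^-1 => // A B mA mB An Bn.
  by rewrite ltNge; apply/negP => eAB; apply: nH; exists (A, B).
have {H} [AB ABP] := choice H.
have ABc : (fun n => mu ((AB n).1 `|` (AB n).2)) @ \oo --> 0%E.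
  apply: mu_pgp; [by move=> n; case: (ABP n)..|].
  apply/ereal_cvg0P => [n|r r0].
    by case: (ABP n) => ? _ _ _ _; rewrite le_max nonadd_ge0.
  have := near_infty_natSinv_lt (PosNum r0).
  apply: filterS => n /=; rewrite -lte_fin => nr; case: (ABP n) => _ _ a b _.
  by rewrite gt_max (lt_trans a)// (lt_trans b).
have AB0 n : (0 <= mu ((AB n).1 `|` (AB n).2))%E.
  by case: (ABP n) => *; apply: nonadd_ge0; exact: measurableU.
have [N _ /(_ N (leqnn _))/=] := (ereal_cvg0P AB0).1 ABc e e0.
by rewrite ltNge; case: (ABP N) => _ _ _ _ ->.
Qed.

Lemma converges_cauchy (f : nat -> {mfun X >-> R}) g :
  converges_for (norm0 mu) f g -> cauchy_for (norm0 mu) f.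
Proof.
move=> /converges_norm0P fg; apply/cauchy_norm0P => e e0.
have [r r0 rP] := pgp_lt e0.
(* The bound [e / 2] puts [{|f m - f n| > e}] inside the union of the two sets around [g]; the bound
   [r] makes that union small. *)
have s0 : 0 < Num.min (e / 2) r by rewrite lt_min r0 divr_gt0.
have [N _ NP] := fg _ s0; exists N => m n /NP/= Nm /NP/= Nn.
apply: nonadd_lt (rP _ _ _ _ (lt_le_trans Nm _) (lt_le_trans Nn _)).
- exact: measurable_gt_normB.
- by apply: measurableU; exact: measurable_gt_normB.
- move=> x /= emn; apply/orP; apply: contraLR emn.
  rewrite negb_or -!leNgt => /andP[mx nx].
  have s2 : Num.min (e / 2) r <= e / 2 by rewrite ge_min lexx.
  have := ler_distD (g x) (f m x) (f n x); rewrite (distrC (g x)); lra.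
- exact: measurable_gt_normB.
- exact: measurable_gt_normB.
- by rewrite lee_fin ge_min lexx orbT.
- by rewrite lee_fin ge_min lexx orbT.
Qed.

Lemma pgp_scale : exists r : nat -> R,
  [/\ forall k, 0 < r k, forall k, r k <= 2^-1 ^+ k &
    forall k A B, measurable A -> measurable B ->
    (mu A < (r k.+1)%:E)%E -> (mu B < (r k.+1)%:E)%E ->
    (mu (A `|` B) < (r k)%:E)%E].
Proof.
(* The modulus is made total, with junk value 0 for [e <= 0], so that it can be iterated in the
   recursion for [r]. *)
have /choice[D DP] (e : R) : exists r : R, 0 < e ->
    0 < r /\ forall A B, measurable A -> measurable B ->
    (mu A < r%:E)%E -> (mu B < r%:E)%E -> (mu (A `|` B) < e%:E)%E.
  have [/pgp_lt[r r0 rP]|_] := ltP 0 e; last by exists 0.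
  by exists r.
pose r := fix r k : R :=
  if k is k'.+1 then Num.min (D (r k')) (2^-1 ^+ k) else 1.
have r0 k : 0 < r k.
  elim: k => //= k IH; rewrite lt_min exprn_gt0 ?andbT ?invr_gt0//.
  by case: (DP _ IH).
exists r; split=> //.
  by case=> [|k]; rewrite ?expr0//= ge_min lexx orbT.
move=> k A B mA mB Ar Br; case: (DP _ (r0 k)) => _; apply => //.
  by apply: lt_le_trans Ar _; rewrite lee_fin /= ge_min lexx.
by apply: lt_le_trans Br _; rewrite lee_fin /= ge_min lexx.
Qed.

(** Induction on [l] for all [k] at once: [E k] is split off, and the remaining union, which starts
    at [k.+1], has measure below [r k.+1]. *)
Lemma pgp_bigcup_lt (r : nat -> R) (E : nat -> set X) :
  (forall k A B, measurable A -> measurable B ->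
    (mu A < (r k.+1)%:E)%E -> (mu B < (r k.+1)%:E)%E ->
    (mu (A `|` B) < (r k)%:E)%E) ->
  (forall k, measurable (E k)) ->
  (forall k, (mu (E k) < (r k.+1)%:E)%E) ->
  forall l k, (mu (\bigcup_(n in [set n | (k <= n <= k + l)%N]) E n)
    < (r k)%:E)%E.
Proof.
move=> rP mE Er; have mU P : measurable (\bigcup_(n in P) E n).
  by apply: bigcup_measurable.
elim=> [|l IH] k.
  (* Doubling [E k] lets [rP] turn the bound [r k.+1] into [r k]. *)
  rewrite [X in mu X](_ : _ = E k `|` E k); last first.
    rewrite setUid; apply/seteqP; split => [x [n /=]|x Ekx].
      by rewrite addn0 -eqn_leq => /eqP <-.
    by exists k => //=; rewrite addn0 leqnn.
  exact: rP.
rewrite [X in mu X](_ : _ =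
    E k `|` \bigcup_(n in [set n | (k.+1 <= n <= k.+1 + l)%N]) E n).
  exact: rP.
apply/seteqP; split => [x [n /=]|x [Ekx|[n /= /andP[kn nl]] Enx]].
- rewrite leq_eqVlt addnS -addSn => /andP[/predU1P[<- _|kn nl]]; first by left.
  by right; exists n => //=; rewrite kn.
- by exists k => //=; rewrite leqnn leq_addr.
- by exists n => //=; rewrite ltnW//= addnS -addSn.
Qed.

(** * Completeness from (C) *)

Hypothesis mu_C : property_C mu.

Lemma cauchy_converges (f : nat -> {mfun X >-> R}) :
  cauchy_for (norm0 mu) f -> exists g, converges_for (norm0 mu) f g.
Proof.
move=> /cauchy_norm0P cf.
have [r [r0 r2 rP]] := pgp_scale.
have /choice[N NP] k := cf _ (r0 k.+1).
(* Partial sums make both [p k] and [p k.+1] at least [N k], as the bound on [mu (E k)] requires. *)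
pose p k := (\sum_(i < k.+1) N i)%N.
have Np k : (N k <= p k)%N by rewrite /p big_ord_recr/= leq_addl.
have NpS k : (N k <= p k.+1)%N.
  by rewrite /p big_ord_recr/= (leq_trans (Np k))// leq_addr.
pose E k := [set x | r k.+1 < `|f (p k.+1) x - f (p k) x|].
have mE k : measurable (E k) by exact: measurable_gt_normB.
pose F k := \bigcup_(n in [set n | (k <= n)%N]) E n.
have mF k : measurable (F k) by apply: bigcup_measurable.
have F0 : (fun k => mu (F k)) @ \oo --> 0%E.
  apply: mu_C => //; apply/ereal_cvg0P => [k|e e0].
    apply: (@le_trans _ _ (mu (\bigcup_(n in [set n | (k <= n <= k + 0)%N]) E n))).
      by apply: nonadd_ge0; apply: bigcup_measurable.
    by apply: ereal_sup_ubound; exists 0%N.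
  have := expr_half_lt e0; apply: filterS => k ke.
  apply: (@le_lt_trans _ _ (r k)%:E); last first.
    by rewrite lte_fin (le_lt_trans (r2 k)).
  apply: ge_ereal_sup => _ [l _ <-]; apply/ltW.
  by apply: pgp_bigcup_lt => // j; apply: NP.
pose Z := \bigcap_k F k.
have mZ : measurable Z by apply: bigcap_measurableType.
(* The indicator makes [s] converge at every point, so that the limit is measurable. Since [Z] lies
   in each [F i], nothing changes off [F i]. *)
pose s k x := f (p k) x * \1_(~` Z) x.
have sE k i j x : ~ F k x -> (k <= i)%N -> (i <= j)%N ->
    `|s j x - s i x| <= 2^-1 ^+ i.
  move=> nF; apply: (@steps_le_expr_dist _ (s ^~ x)) => n kn.
  have -> : s n.+1 x - s n x = f (p n.+1) x - f (p n) x.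
    by rewrite /s indicE mem_set ?mulr1// => /(_ k I).
  apply: le_trans (r2 n.+1); rewrite leNgt; apply/negP => nE.
  by apply: nF; exists n.
have sc x : cvgn (s ^~ x) /\
    forall k, ~ F k x -> forall i, (k <= i)%N -> `|limn (s ^~ x) - s i x| <= 2^-1 ^+ i.
  split=> [|k nF]; last first.
    by case: (@expr_dist_cvg _ (s ^~ x) k) => // i j; exact: sE.
  have [Zx|] := pselect (Z x).
    suff -> : s ^~ x = cst 0 by exact: is_cvg_cst.
    by apply/funext => k; rewrite /s indicE memNset ?mulr0//; apply.
  move/existsNP => [k /not_implyP[_ nF]].
  by case: (@expr_dist_cvg _ (s ^~ x) k) => // i j; exact: sE.
have mg : measurable_fun setT (fun x => limn (s ^~ x)).
  apply: (@measurable_fun_cvg _ _ _ _ s) => [k|x _]; last by case: (sc x).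
  apply: measurable_funM => //.
  by apply: measurable_indic; exact: measurableC.
pose g : {mfun X >-> R} := mfun_Sub (mem_set mg).
exists g; apply/converges_norm0P => e e0.
have [t t0 tP] := pgp_lt e0.
(* Here [e / 2] serves the pointwise estimate off [F i], and [t] the measures of the two exceptional
   sets. *)
have u0 : 0 < Num.min (e / 2) t by rewrite lt_min t0 divr_gt0.
have [i [iu Fi]] : exists i, 2^-1 ^+ i < Num.min (e / 2) t /\ (mu (F i) < t%:E)%E.
  have F0' : \forall k \near \oo, (mu (F k) < t%:E)%E.
    exact: (ereal_cvg0P (fun k => nonadd_ge0 mu (mF k))).1.
  have [M _ MP] := filterI (expr_half_lt u0) F0'.
  by exists M; apply: MP => /=.
move: iu; rewrite lt_min => /andP[ie it].
have rle : r i.+1 <= 2^-1 ^+ i.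
  by apply: le_trans (r2 _) _; rewrite exprS ler_piMl ?exprn_ge0//; lra.
(* Since [N i <= p i], the Cauchy bound applies to the pair [n], [p i]. *)
exists (N i) => // n /= Nn.
apply: (@nonadd_lt _ ([set x | r i.+1 < `|f n x - f (p i) x|] `|` F i)).
- exact: (measurable_gt_normB (f n) g).
- by apply: measurableU => //; exact: measurable_gt_normB.
- move=> x /= efg; have [|nF] := pselect (F i x); first by right.
  left; rewrite /= ltNge; apply: contraL efg; rewrite -leNgt => fr.
  have := (sc x).2 _ nF i (leqnn _).
  have -> : s i x = f (p i) x.
    by rewrite /s indicE mem_set ?mulr1// => /(_ i I).
  rewrite distrC => gi.
  (* Both distances to [f (p i) x] are at most [2^-1 ^+ i < e / 2]. *)
  have := ler_distD (f (p i) x) (f n x) (limn (s ^~ x)); lra.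
- apply: tP => //; first exact: measurable_gt_normB.
  apply: lt_trans (NP i n (p i) Nn (Np i)) _.
  by rewrite lte_fin; lra.
Qed.

Lemma cauchy_norm0_cvg (f : nat -> {mfun X >-> R}) :
  cauchy_for (norm0 mu) f <-> exists g, converges_for (norm0 mu) f g.
Proof.
by split=> [|[g]]; [exact: cauchy_converges|exact: converges_cauchy].
Qed.

(** * Passage to the quotient through representatives *)

Hypothesis mu_null : null_additive mu.

Lemma L0_norm_pi_sub f g :
  L0_norm (\pi_(L0 mu_null) f - \pi_(L0 mu_null) g) = norm0 mu (f - g).
Proof. by rewrite L0_piN L0_piD L0_normE. Qed.

Lemma cauchy_L0_cvg (u : nat -> L0 mu_null) :
  cauchy_for (@L0_norm _ _ _ _ mu_null) u <->
  exists v, converges_for (@L0_norm _ _ _ _ mu_null) u v.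
Proof.
pose f n := repr (u n).
have uf : u = fun n => \pi_(L0 mu_null) (f n).
  by apply/funext => n; rewrite /f reprK.
have cu : cauchy_for (@L0_norm _ _ _ _ mu_null) u <-> cauchy_for (norm0 mu) f.
  by rewrite uf; split=> H e /H[n0 n0P]; exists n0 => m n mn nn;
    have := n0P m n mn nn; rewrite L0_norm_pi_sub.
have vu g : converges_for (@L0_norm _ _ _ _ mu_null) u (\pi_(L0 mu_null) g) <->
    converges_for (norm0 mu) f g.
  rewrite uf /converges_for.
  by under eq_fun do rewrite L0_norm_pi_sub.
split=> [/(proj1 cu) cf|[v]].
  have [g fg] := (cauchy_norm0_cvg f).1 cf.
  by exists (\pi_(L0 mu_null) g); exact: (vu g).2.
rewrite -[v]reprK => uv; apply: cu.2; apply: (cauchy_norm0_cvg f).2.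
by exists (repr v); exact: (vu _).1.
Qed.

End nonadditive.

Theorem theorem5p4 (R : realType) (d : measure_display) (X : measurableType d)
    (mu : nonadditive_measure X R)
    (mu_C : property_C mu) (mu_pgp : pseudometric_generating mu) :
  (forall f : nat -> {mfun X >-> R},
     cauchy_for (norm0 mu) f <->
     exists g : {mfun X >-> R}, converges_for (norm0 mu) f g) /\
  (forall (mu_null : null_additive mu) (u : nat -> L0 mu_null),
     cauchy_for (@L0_norm _ _ _ _ mu_null) u <->
     exists v : L0 mu_null, converges_for (@L0_norm _ _ _ _ mu_null) u v).
Proof.
split=> [f|mu_null u]; first exact: cauchy_norm0_cvg.
exact: cauchy_L0_cvg.
Qed.
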